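(* Let $\Gamma$ be a finite connected simplicial graph. Every loxodromic $g\in A(\Gamma)$ of syllable length $2$ has an integer asymptotic translation length on $\Gamma^e$. Precisely, if the support of $g$ is $\{v_1,v_2\}$, then $\tau(g)=2d_\Gamma(v_1,v_2)-4$.
   Context: For a finite connected simplicial graph $\Gamma$ with edge metric $d_\Gamma$, $A(\Gamma)=\langle v\in V(\Gamma)\mid [u,v]=1 \text{ for all } \{u,v\}\in E(\Gamma)\rangle$ is its right-angled Artin group. A syllable is an element $v^\ell$ with $v\in V(\Gamma)$, $\ell\in\mathbb{Z}\setminus\{0\}$; the syllable length of $g$ is the smallest number of syllables whose product is $g$. The support of $g$ is the set of vertices occurring in a reduced word representing $g$ (independent of the reduced word). For $x,h\in A(\Gamma)$ write $x^h=h^{-1}xh$. The extension graph $\Gamma^e$ is the simplicial graph with vertex set $\{v^g\mid v\in V(\Gamma), g\in A(\Gamma)\}\subset A(\Gamma)$, where two distinct vertices are joined by an edge exactly when they commute in $A(\Gamma)$. It carries the edge metric $d_{\Gamma^e}$. $A(\Gamma)$ acts on $\Gamma^e$ on the right by conjugation, $x\mapsto x^g$. The asymptotic translation length is $\tau(g)=\lim_{n\to\infty} d_{\Gamma^e}(x,x^{g^n})/n$ (independent of the vertex $x$); $g$ is loxodromic if $\tau(g)>0$. *)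

(* Defs.v *)
From HB Require Import structures.
From mathcomp Require Import all_boot all_order all_algebra.
From mathcomp Require Import generic_quotient.
From mathcomp Require Import all_classical reals topology normedtype sequences.

Set Implicit Arguments.
Unset Strict Implicit.
Unset Printing Implicit Defensive.

Import Order.TTheory GRing.Theory Num.Theory.
Import numFieldNormedType.Exports.

(* [0] when no natural number satisfies [P]. *)
Definition least (P : nat -> Prop) : nat :=
  xget 0 (fun n => P n /\ forall m, P m -> n <= m).

(* The edge metric; [0] when [x] and [y] lie in different components. *)
Definition graph_dist (T : eqType) (adj : rel T) (x y : T) : nat :=
  least (fun n => exists p : seq T,
    [/\ path adj x p, last x p = y & size p = n]).

Section Raag.
Variables (V : finType) (adj : rel V).

(* The letter [(v, true)] is the generator [v], and [(v, false)] its inverse. *)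
Local Notation word := (seq (V * bool)).

Inductive raag_eq : word -> word -> Prop :=
| raag_refl w : raag_eq w w
| raag_sym w w' : raag_eq w w' -> raag_eq w' w
| raag_trans w w' w'' : raag_eq w w' -> raag_eq w' w'' -> raag_eq w w''
| raag_cancel (s t : word) v b :
    raag_eq (s ++ [:: (v, b); (v, ~~ b)] ++ t) (s ++ t)
| raag_comm (s t : word) u v : adj u v ->
    raag_eq (s ++ [:: (u, true); (v, true)] ++ t)
            (s ++ [:: (v, true); (u, true)] ++ t).

Lemma raag_eq_cat (s t w w' : word) :
  raag_eq w w' -> raag_eq (s ++ w ++ t) (s ++ w' ++ t).
Proof.
elim=> [x|x y _ IH|x y z _ IH1 _ IH2|s' t' v b|s' t' u v uv].
- exact: raag_refl.
- exact: raag_sym.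
- exact: raag_trans IH1 IH2.
- by have := raag_cancel (s ++ s') (t' ++ t) v b; rewrite -!catA.
- by have := raag_comm (s ++ s') (t' ++ t) uv; rewrite -!catA.
Qed.

Lemma raag_eq_cat2 (w1 w1' w2 w2' : word) :
  raag_eq w1 w1' -> raag_eq w2 w2' -> raag_eq (w1 ++ w2) (w1' ++ w2').
Proof.
move=> h1 h2; apply: (@raag_trans _ (w1' ++ w2)).
  exact: (@raag_eq_cat [::] w2 w1 w1').
by have := @raag_eq_cat w1' [::] w2 w2' h2; rewrite !cats0.
Qed.

Definition word_inv (w : word) : word := rev [seq (l.1, ~~ l.2) | l <- w].

Lemma word_inv_cat (w w' : word) :
  word_inv (w ++ w') = word_inv w' ++ word_inv w.
Proof. by rewrite /word_inv map_cat rev_cat. Qed.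

Lemma word_invK : involutive word_inv.
Proof.
move=> w; rewrite /word_inv map_rev revK -map_comp.
by rewrite -[RHS]map_id; apply: eq_map => -[v b] /=; rewrite negbK.
Qed.

Lemma raag_eq_mulwV (w : word) : raag_eq (w ++ word_inv w) [::].
Proof.
elim/last_ind: w => [|w [v b] IH]; first exact: raag_refl.
rewrite -cats1 word_inv_cat; apply: raag_trans IH.
by have := raag_cancel w (word_inv w) v b; rewrite -!catA.
Qed.

Lemma raag_eq_mulVw (w : word) : raag_eq (word_inv w ++ w) [::].
Proof. by have := raag_eq_mulwV (word_inv w); rewrite word_invK. Qed.

Lemma raag_eq_inv (w w' : word) :
  raag_eq w w' -> raag_eq (word_inv w) (word_inv w').
Proof.
move=> h; apply: (@raag_trans _ (word_inv w ++ (w' ++ word_inv w'))).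
  rewrite -[X in raag_eq X _]cats0; apply: raag_eq_cat2; first exact: raag_refl.
  exact/raag_sym/raag_eq_mulwV.
rewrite catA -[X in raag_eq _ X]cat0s.
apply: raag_eq_cat2; last exact: raag_refl.
apply: raag_trans (raag_eq_mulVw w).
by apply: raag_eq_cat2; [exact: raag_refl | exact: raag_sym].
Qed.

Definition raag_eqb (w w' : word) : bool := `[< raag_eq w w' >].

Lemma raag_eqb_refl : reflexive raag_eqb.
Proof. by move=> w; apply/asboolP/raag_refl. Qed.

Lemma raag_eqb_sym : symmetric raag_eqb.
Proof. by move=> w w'; apply/asboolP/asboolP; apply: raag_sym. Qed.

Lemma raag_eqb_trans : transitive raag_eqb.
Proof.
by move=> w w' w'' /asboolP h /asboolP h'; apply/asboolP/(raag_trans h h').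
Qed.

Canonical raag_equiv :=
  EquivRel raag_eqb raag_eqb_refl raag_eqb_sym raag_eqb_trans.

Local Open Scope quotient_scope.

Definition raag : Type := {eq_quot raag_equiv}.
HB.instance Definition _ := Choice.on raag.

Definition word_val (w : word) : raag := \pi_({eq_quot raag_equiv}) w.

Lemma word_valP (w w' : word) : word_val w = word_val w' <-> raag_eq w w'.
Proof.
split=> [/eqmodP /asboolP //|h]; exact/eqmodP/asboolP.
Qed.

Definition word_of (x : raag) : word := repr (x : {eq_quot raag_equiv}).

Lemma word_ofK : cancel word_of word_val.
Proof. by move=> x; rewrite /word_of /word_val reprK. Qed.

Definition raag_one : raag := word_val [::].
Definition raag_mul (x y : raag) : raag := word_val (word_of x ++ word_of y).
Definition raag_inv (x : raag) : raag := word_val (word_inv (word_of x)).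

Lemma word_val_cat (w w' : word) :
  word_val (w ++ w') = raag_mul (word_val w) (word_val w').
Proof.
by apply/word_valP/raag_eq_cat2; apply/word_valP; rewrite word_ofK.
Qed.

Lemma word_val_inv (w : word) :
  word_val (word_inv w) = raag_inv (word_val w).
Proof. by apply/word_valP/raag_eq_inv/word_valP; rewrite word_ofK. Qed.

Lemma raag_mulA : associative raag_mul.
Proof.
move=> x y z; rewrite -(word_ofK x) -(word_ofK y) -(word_ofK z).
by rewrite -!word_val_cat catA.
Qed.

Lemma raag_mul1 : left_id raag_one raag_mul.
Proof. by move=> x; rewrite -(word_ofK x) -word_val_cat. Qed.

Lemma raag_mulr1 : right_id raag_one raag_mul.
Proof. by move=> x; rewrite -(word_ofK x) -word_val_cat cats0. Qed.

Lemma raag_mulV : left_inverse raag_one raag_inv raag_mul.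
Proof.
move=> x; rewrite -(word_ofK x) -word_val_inv -word_val_cat.
exact/word_valP/raag_eq_mulVw.
Qed.

Lemma raag_mulrV : right_inverse raag_one raag_inv raag_mul.
Proof.
move=> x; rewrite -(word_ofK x) -word_val_inv -word_val_cat.
exact/word_valP/raag_eq_mulwV.
Qed.

HB.instance Definition _ := isGroup.Build raag
  raag_mulA raag_mul1 raag_mulr1 raag_mulV raag_mulrV.

Definition gen (v : V) : raag := word_val [:: (v, true)].

Local Open Scope group_scope.

Definition syllable (x : raag) : Prop :=
  exists v (l : nat), (0 < l)%N /\ (x = gen v ^+ l \/ x = gen v ^- l).

Definition syllable_length (g : raag) : nat :=
  least (fun n => exists s : seq raag,
    [/\ size s = n, forall x, x \in s -> syllable x & \prod_(x <- s) x = g]).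

Definition reduced (w : word) : Prop :=
  forall w' : word, word_val w' = word_val w -> (size w <= size w')%N.

Definition raag_support (g : raag) : {set V} :=
  [set v | `[< exists w : word,
     [/\ reduced w, word_val w = g & v \in [seq l.1 | l <- w]] >]]%SET.

(* The extension graph is carried by the subset [ext_vertex] of the group; the
   relation [ext_adj] only holds between elements of this subset. *)
Definition ext_vertex (x : raag) : Prop := exists v g, x = gen v ^ g.

Definition ext_adj : rel raag := fun x y =>
  `[< [/\ ext_vertex x, ext_vertex y, x <> y & commute x y] >].

Definition ext_dist : raag -> raag -> nat := graph_dist ext_adj.

Local Close Scope group_scope.
Local Open Scope classical_set_scope.
Local Open Scope ring_scope.

Definition translation_length (R : realType) (x g : raag) : R :=
  lim ((ext_dist x (x ^ (g ^+ n))%g)%:R / (n%:R : R) @[n --> \oo]).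

(* [translation_length R x g] does not depend on the vertex [x]. *)
Definition loxodromic (R : realType) (g : raag) : Prop :=
  exists2 x, ext_vertex x & 0 < translation_length R x g.

End Raag.

(* Main.v *)
Require Import Defs.
From mathcomp Require Import all_boot all_order all_algebra.
From mathcomp Require Import all_classical reals topology normedtype sequences.
From mathcomp Require Import ring lra zify.

(** Let [g = u^a w^b] with [u] and [w] at distance [d] in the graph.  If
    [d <= 2], then [g] commutes with a vertex in both stars and is not
    loxodromic.  If [d >= 3], let [p] and [q] be the neighbours of [u] and [w]
    on a geodesic from [u] to [w]; walking from [p] to [q] and back along the
    [w^b]-translate gives [d(p, p^g) <= 2(d - 2)].

    For the lower bound, kill all generators but [u] and [w]; this sends
    [A(Gamma)] onto the free product [<u> * <w>].  Give the edges of its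
    Bass-Serre tree length [d - 2] and send the vertex [v^x] of the extension
    graph to a point on the edge of the image of [x], at a position that
    depends only on [d(u, v)] and is an endpoint of the edge when [v] lies in
    the star of [u] or of [w].  Commuting vertices [v^x] and [v'^y] satisfy
    [x y^-1 = a b] with [a] and [b] supported in the stars of [v] and [v'], so
    they are sent to points at distance at most 1; on the tree, [g] has
    translation length [2(d - 2)].  The factorization [x y^-1 = a b] follows
    from the solution of the word problem in [A(Gamma)]. *)

Set Implicit Arguments.
Unset Strict Implicit.
Unset Printing Implicit Defensive.

Import Order.TTheory GRing.Theory Num.Theory.
Import numFieldNormedType.Exports.

(** * The word problem *)

Section WordProblem.
Variables (V : finType) (adj : rel V).
Hypotheses (adj_sym : symmetric adj) (adj_irr : irreflexive adj).

Local Notation word := (seq (V * bool)).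

Definition in_link (v : V) (t : word) := all (fun l => adj v l.1) t.

Definition reducible (w : word) := exists s v b t r,
  in_link v t /\ w = s ++ (v, b) :: t ++ (v, ~~ b) :: r.

(* Crisp, Godelle and Wiest's pilings: [None] is the blank bead that a letter
   leaves on the stacks of the vertices it does not commute with.  Two reduced
   words are equal in the group iff they have the same piling. *)
Local Notation piling := (V -> seq (option bool)).

Definition push (p : piling) (l : V * bool) : piling := fun u =>
  if u == l.1 then Some l.2 :: p u else if adj l.1 u then p u else None :: p u.

Definition pop (p : piling) (v : V) : piling := fun u =>
  if adj v u then p u else behead (p u).

(** Right multiplication by a letter: a letter meeting its inverse on top of its own stack cancels
    it. *)
Definition act (p : piling) (l : V * bool) : piling :=
  if ohead (p l.1) == Some (Some (~~ l.2)) then pop p l.1 else push p l.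

Definition pil (w : word) : piling := foldl push (fun=> [::]) w.

Lemma pil_rcons w l : pil (rcons w l) = push (pil w) l.
Proof. by rewrite /pil -cats1 foldl_cat. Qed.

Lemma pushK p v b : pop (push p (v, b)) v = p.
Proof.
apply/funext => u; rewrite /pop /push; case: eqP => [->|_] /=.
  by rewrite adj_irr.
by case: (adj v u).
Qed.

Lemma pushC p l m : adj l.1 m.1 -> push (push p l) m = push (push p m) l.
Proof.
move=> lm; apply/funext => u; rewrite /push.
case: (eqVneq u m.1) => [->|um].
  by rewrite lm; case: eqVneq lm => // ->; rewrite adj_irr.
case: (eqVneq u l.1) => [->|ul]; first by rewrite adj_sym lm.
by case: (adj m.1 u); case: (adj l.1 u).
Qed.

Lemma push_adj p l v : adj v l.1 -> push p l v = p v.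
Proof.
by move=> vl; rewrite /push adj_sym vl; case: eqVneq vl => // ->; rewrite adj_irr.
Qed.

Lemma pop_adj p u v : adj v u -> pop p u v = p v.
Proof. by move=> vu; rewrite /pop adj_sym vu. Qed.

Lemma act_adj p l v : adj v l.1 -> act p l v = p v.
Proof.
by move=> vl; rewrite /act; case: ifP => _; [apply: pop_adj|apply: push_adj].
Qed.

Lemma pil_in_link s t v : in_link v t -> pil (s ++ t) v = pil s v.
Proof.
elim/last_ind: t => [|t l IH]; first by rewrite cats0.
by rewrite /in_link all_rcons => /andP[vl /IH]; rewrite -rcons_cat pil_rcons push_adj.
Qed.

Lemma pil_insert s t v b : in_link v t ->
  pil (s ++ (v, b) :: t) = push (pil (s ++ t)) (v, b).
Proof.
elim/last_ind: t => [|t l IH]; first by rewrite cats0 cats1 pil_rcons.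
rewrite /in_link all_rcons => /andP[vl /IH h].
by rewrite -rcons_cons -!rcons_cat !pil_rcons h pushC.
Qed.

(** A later letter outside the link of [v] would have covered the bead, so the letter of [v] can be
    shuffled to the end. *)
Lemma pil_top w v b : ohead (pil w v) = Some (Some b) ->
  exists s t, in_link v t /\ w = s ++ (v, b) :: t.
Proof.
elim/last_ind: w => // w [u c] IH.
rewrite pil_rcons /push /=; case: eqVneq => [<- [<-]|_].
  by exists w, [::]; split=> //; rewrite cats1.
case: ifP => // uv /IH[s [t [tv ->]]]; exists s, (rcons t (u, c)); split.
  by rewrite /in_link all_rcons /= adj_sym uv.
by rewrite rcons_cat.
Qed.

Lemma reducible_catr w s : reducible w -> reducible (w ++ s).
Proof.
move=> [s' [v [b [t [r [vt ->]]]]]]; exists s', v, b, t, (r ++ s).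
by rewrite -!catA /= -catA.
Qed.

Lemma reducible_rcons w v b : reducible (rcons w (v, b)) <->
  reducible w \/ ohead (pil w v) = Some (Some (~~ b)).
Proof.
split=> [[s [u [c [t [r [ut]]]]]]|[|/pil_top[s [t [vt ->]]]]].
- elim/last_ind: r => [|r l _].
    rewrite cats1 -rcons_cons -rcons_cat => e; case/rcons_inj: e ut => -> <- -> ut.
    by right; rewrite pil_insert //= /push /= eqxx negbK.
  rewrite -rcons_cons -rcons_cat -rcons_cons -rcons_cat => /rcons_inj[-> _].
  by left; exists s, u, c, t, r.
- by rewrite -cats1; apply: reducible_catr.
- by exists s, v, (~~ b), t, [::]; rewrite negbK -cats1 -catA.
Qed.

Lemma reducible_insert s t v b : in_link v t ->
  reducible (s ++ t) -> reducible (s ++ (v, b) :: t).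
Proof.
elim/last_ind: t => [|t [u c] IH].
  by rewrite cats0; move=> _; apply: reducible_catr.
rewrite /in_link all_rcons /= => /andP[vu vt].
rewrite -rcons_cons -!rcons_cat => /reducible_rcons h; apply/reducible_rcons.
case: h => [/(IH vt)|h]; first by left.
by right; rewrite pil_insert // push_adj //= adj_sym.
Qed.

(** On an arbitrary piling, a letter followed by its inverse need not act trivially: popping a bead
    may uncover its inverse, which the next letter pops too. Irreducible words exclude this. *)
Definition valid (p : piling) := exists2 w, ~ reducible w & p = pil w.

Lemma valid_act p l : valid p -> valid (act p l).
Proof.
case: l => v b [w rw ->]; rewrite /act /=; case: eqP => [/pil_top[s [t [vt e]]]|h].
  exists (s ++ t); last by rewrite e pil_insert // pushK.
  by move/(reducible_insert (~~ b) vt); rewrite -e.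
exists (rcons w (v, b)); last by rewrite pil_rcons.
by move=> /reducible_rcons[].
Qed.

Lemma valid_top p v b : valid p -> ohead (p v) = Some (Some b) ->
  exists2 q, p = push q (v, b) & ohead (q v) <> Some (Some (~~ b)).
Proof.
move=> [w rw ->] /pil_top[s [t [vt e]]]; exists (pil (s ++ t)).
  by rewrite e pil_insert.
move=> h; apply: rw; rewrite e; move: h; rewrite pil_in_link //.
move=> h; rewrite -cat_rcons; apply: reducible_catr.
by apply/reducible_rcons; right.
Qed.

Lemma act_cancel p v b : valid p -> act (act p (v, b)) (v, ~~ b) = p.
Proof.
move=> pv; rewrite {2}/act /=; case: eqP => [/(valid_top pv)[q -> h]|_].
  by rewrite pushK /act /=; case: eqP.
have e : push p (v, b) v = Some b :: p v by rewrite /push eqxx.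
by rewrite /act /= e /= negbK eqxx pushK.
Qed.

(** Neither letter changes the stack of the other, so the choice between pop and push does not
    depend on the order. In the mixed cases, validity exhibits the popped bead as a push that
    commutes past the other letter. *)
Lemma act_comm p l m : adj l.1 m.1 -> valid p ->
  act (act p l) m = act (act p m) l.
Proof.
move=> lm pv; rewrite {1 3}/act act_adj ?[in RHS]act_adj // 1?adj_sym //.
rewrite /act; case: eqP => [hm|_]; case: eqP => [hl|_] //.
- apply/funext => u; rewrite /pop.
  by case: (adj m.1 u); case: (adj l.1 u).
- have [q -> _] := valid_top pv hm.
  by rewrite pushK pushC ?pushK //= adj_sym.
- have [q -> _] := valid_top pv hl.
  by rewrite pushK pushC ?pushK.
- exact: pushC.
Qed.

Lemma valid_foldl p w : valid p -> valid (foldl act p w).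
Proof. by elim: w p => //= l w IH p pv; apply/IH/valid_act. Qed.

Lemma act_raag_eq p w w' : raag_eq adj w w' -> valid p ->
  foldl act p w = foldl act p w'.
Proof.
move=> h; elim: h p => [//|x y _ IH p /IH->//|x y z _ IH1 _ IH2 p pv||].
- by rewrite IH1 // IH2.
- by move=> s t v b p pv; rewrite !foldl_cat /= act_cancel //; apply: valid_foldl.
- move=> s t u v uv p pv; rewrite !foldl_cat /= act_comm //.
  exact: valid_foldl.
Qed.

Lemma act_irreducible w : ~ reducible w -> foldl act (fun=> [::]) w = pil w.
Proof.
elim/last_ind: w => // w [v b] IH h.
rewrite -cats1 foldl_cat /= IH; last first.
  by move=> r; apply: h; rewrite -cats1; apply: reducible_catr.
rewrite cats1 pil_rcons /act /=; case: eqP => // e.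
by case: h; apply/reducible_rcons; right.
Qed.

Lemma pil_raag_eq w w' : ~ reducible w -> ~ reducible w' ->
  raag_eq adj w w' -> pil w = pil w'.
Proof.
move=> rw rw' e; rewrite -!act_irreducible //; apply: act_raag_eq => //.
by exists [::] => // -[[|? ?] [? [? [? [? []]]]]].
Qed.

(** The two pilings agree. On the stack of [l'.1] the second word ends with a genuine bead, whereas
    [l] would leave a blank there if it neither equalled nor commuted with [l'.1]. *)
Lemma last_letters w w' l l' :
    ~ reducible (rcons w l) -> ~ reducible (rcons w' l') ->
  raag_eq adj (rcons w l) (rcons w' l') -> l.1 = l'.1 \/ adj l.1 l'.1.
Proof.
move=> r r' /(pil_raag_eq r r') /(congr1 (fun p => ohead (p l'.1))).
rewrite !pil_rcons /push eqxx; case: eqVneq => [->|_]; first by left.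
by case: ifP => //; right.
Qed.

End WordProblem.

(** * Commuting conjugates of generators *)

Lemma cat_eq_cons (T : Type) (a b s t : seq T) x : a ++ b = s ++ x :: t ->
  (exists t1, a = s ++ x :: t1 /\ t = t1 ++ b) \/
  (exists s1, b = s1 ++ x :: t /\ s = a ++ s1).
Proof.
elim: a s => [|y a IH] [|z s] //=; first by move=> ->; right; exists [::].
- by move=> ->; right; exists (z :: s).
- by case=> -> <-; left; exists a.
- by case=> -> /IH[[t1 [-> ->]]|[s1 [-> ->]]]; [left; exists t1|right; exists s1].
Qed.

Section Centralizer.
Variables (V : finType) (adj : rel V).
Hypotheses (adj_sym : symmetric adj) (adj_irr : irreflexive adj).

Local Notation word := (seq (V * bool)).
Local Notation val := (word_val adj).
Local Notation gen := (gen adj).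
Local Notation in_link := (in_link adj).
Local Notation reducible := (reducible adj).

Local Open Scope group_scope.

Definition in_star (v : V) (t : word) :=
  all (fun l => (l.1 == v) || adj v l.1) t.

Lemma val_nil : val [::] = 1. Proof. by []. Qed.

Lemma val_cat w w' : val (w ++ w') = val w * val w'.
Proof. exact: word_val_cat. Qed.

Lemma val_inv w : val (word_inv w) = (val w)^-1.
Proof. exact: word_val_inv. Qed.

Lemma val_letter v b : val [:: (v, b)] = if b then gen v else (gen v)^-1.
Proof. by case: b => //; rewrite -val_inv. Qed.

Lemma val_cons v b w :
  val ((v, b) :: w) = (if b then gen v else (gen v)^-1) * val w.
Proof. by rewrite -cat1s val_cat val_letter. Qed.

Lemma gen_commute u v : adj u v -> commute (gen u) (gen v).
Proof.
move=> uv; rewrite /commute -!val_cat.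
exact/word_valP/(raag_comm [::] [::] uv).
Qed.

Lemma star_commute v t : in_star v t -> commute (gen v) (val t).
Proof.
elim: t => [|[u b] t IH] /=; first by rewrite val_nil => _; apply: commute1.
move=> /andP[vu /IH vt]; rewrite val_cons; apply: commuteM => //.
have vu' : commute (gen v) (gen u).
  by case/orP: vu => [/eqP->|/gen_commute //]; apply: commute_refl.
by case: b; last apply: commuteV.
Qed.

Lemma in_link_star v t : in_link v t -> in_star v t.
Proof. by apply: sub_all => l ->; rewrite orbT. Qed.

Lemma link_commute v b t : in_link v t -> commute (val [:: (v, b)]) (val t).
Proof.
move=> /in_link_star/star_commute vt; rewrite val_letter.
by case: b => //; apply/commute_sym/commuteV/commute_sym.
Qed.

Lemma reducible_inv w : reducible (word_inv w) -> reducible w.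
Proof.
move=> [s [v [b [t [r [vt e]]]]]]; rewrite -[w]word_invK e.
exists (word_inv r), v, b, (word_inv t), (word_inv s); split.
  by rewrite /in_link all_rev all_map.
rewrite word_inv_cat -cat1s word_inv_cat word_inv_cat -cat1s word_inv_cat.
by rewrite -!catA /= negbK.
Qed.

Lemma val_reducible w : reducible w ->
  exists2 w', (size w' < size w)%N & val w = val w'.
Proof.
move=> [s [v [b [t [r [vt ->]]]]]]; exists (s ++ t ++ r).
  by rewrite !size_cat /= size_cat /=; lia.
rewrite !val_cat !val_cons !val_cat !val_cons -!val_letter.
rewrite (mulgA (val t)) -(link_commute _ vt) !mulgA !val_letter.
by case: b => /=; rewrite ?mulgK ?mulgVK.
Qed.

Section Irreducible.
Variables (v : V) (c : bool) (z : word).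
Hypotheses (z_irr : ~ reducible z)
  (z_left : forall s m t, z = s ++ m :: t -> in_link m.1 s ->
     ~~ ((m.1 == v) || adj v m.1)).

(** Letters of [z] are appended one at a time. A new letter could cancel only against [z1], making
    [z] reducible, or against the middle letter or [word_inv z]; in the last two cases it moves to
    the front of [z] and lies in the star of [v]. *)
Lemma conj_prefix_irreducible z1 z2 : z = z1 ++ z2 ->
  ~ reducible (word_inv z ++ (v, c) :: z1).
Proof.
elim/last_ind: z1 z2 => [|z1 [q b] IH] z2 ez.
  rewrite cats1 => /(reducible_rcons adj_sym adj_irr)[/reducible_inv //|].
  move=> /(pil_top adj_sym)[s [t [vt e]]].
  have := congr1 (@word_inv V) e; rewrite word_invK -cat1s !word_inv_cat -catA.
  by move=> /z_left; rewrite eqxx /in_link all_rev all_map; move=> /(_ vt).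
rewrite -rcons_cons -rcons_cat => /(reducible_rcons adj_sym adj_irr)[|].
  by move: ez; rewrite cat_rcons => /IH.
move=> /(pil_top adj_sym)[s [t [qt e0]]];
  case: (cat_eq_cons e0) => [[t1 [_ et]]|[s1 [e _]]].
  move: qt; rewrite et /in_link all_cat /= => /and3P[_ qv qz1].
  move: ez; rewrite cat_rcons => /z_left /(_ qz1).
  by rewrite /= adj_sym qv orbT.
case: s1 e => [[ev _ et]|_ s1 [_ e]].
  move: ez; rewrite cat_rcons => /z_left; rewrite /= ev eqxx /=.
  by rewrite et => /(_ qt).
apply: z_irr; rewrite ez e cat_rcons; exists s1, q, (~~ b), t, z2.
by rewrite negbK -catA.
Qed.

(** The last letter of [z] is outside the star of [v'], so it blocks the final letter from
    cancelling. *)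
Lemma conj_rcons_irreducible v' c' :
    (forall m t z', z = z' ++ m :: t -> in_link m.1 t ->
       ~~ ((m.1 == v') || adj v' m.1)) -> z <> [::] ->
  ~ reducible (word_inv z ++ (v, c) :: rcons z (v', c')).
Proof.
move=> z_right; case/lastP ez : {1}z => [//|z' l] _.
have zl : ~~ ((l.1 == v') || adj v' l.1).
  by apply: (z_right l [::] z'); rewrite ?cats1.
rewrite -rcons_cons -rcons_cat => /(reducible_rcons adj_sym adj_irr)[|].
  by apply: (@conj_prefix_irreducible z [::]); rewrite cats0.
move=> /(pil_top adj_sym)[s [t [v't]]]; rewrite ez -rcons_cons -rcons_cat.
case/lastP: t v't => [_|t l'].
  by rewrite cats1 => /rcons_inj[_ e]; rewrite e eqxx in zl.
rewrite -rcons_cons -rcons_cat /in_link all_rcons => /andP[a _] /rcons_inj[_ e].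
by rewrite e a orbT in zl.
Qed.

End Irreducible.

(* If no letter can be shuffled out of [z] to the left into the star of [v] or
   to the right into the star of [v'], then [z^-1 v z v'] and [v' z^-1 v z] are
   both reduced, and comparing last letters contradicts the choice of [z]. *)
Lemma commute_conj_gen v v' z : commute (gen v ^ val z) (gen v') ->
  exists a b, [/\ in_star v a, in_star v' b & val z = val a * val b].
Proof.
have [n] := ubnP (size z); elim: n => // n IH in z *.
rewrite ltnS => zn cz.
have [/val_reducible[z' lz ez]|z_irr] := pselect (reducible z).
  by rewrite ez; apply: IH; [exact: leq_trans lz zn|rewrite -ez].
(* A letter moved out to the left commutes with [v], so dropping it leaves the conjugate unchanged;
   it is put into the factor [a]. *)
have [[s [[q b] [t [ez qs qv]]]]|z_left] := pselect (exists s m t,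
    [/\ z = s ++ m :: t, in_link m.1 s & (m.1 == v) || adj v m.1]).
  have ez' : val z = val [:: (q, b)] * val (s ++ t).
    by rewrite ez -cat1s !val_cat !mulgA (link_commute _ qs).
  have qv' : in_star v [:: (q, b)] by rewrite /= andbT.
  have [||a [a' [va va' e]]] := IH (s ++ t).
  - by apply: leq_trans zn; rewrite ez !size_cat /= addnS.
  - move: cz; rewrite ez' conjgM.
    suff -> : gen v ^ val [:: (q, b)] = gen v by [].
    by rewrite conjgE (star_commute qv') mulKg.
  exists ((q, b) :: a), a'; split=> //; first by rewrite /= qv.
  by rewrite ez' e -[_ :: a]cat1s val_cat mulgA.
have [[s [[q b] [t [ez qt qv]]]]|z_right] := pselect (exists s m t,
    [/\ z = s ++ m :: t, in_link m.1 t & (m.1 == v') || adj v' m.1]).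
  have ez' : val z = val (s ++ t) * val [:: (q, b)].
    by rewrite ez -cat1s !val_cat -!mulgA (link_commute _ qt).
  have qv' : in_star v' [:: (q, b)] by rewrite /= andbT.
  have [||a [a' [va va' e]]] := IH (s ++ t).
  - by apply: leq_trans zn; rewrite ez !size_cat /= addnS.
  - apply: (conjg_inj (val [:: (q, b)])); rewrite conjMg [RHS]conjMg -conjgM -ez'.
    suff -> : gen v' ^ val [:: (q, b)] = gen v' by [].
    by rewrite conjgE (star_commute qv') mulKg.
  exists a, (rcons a' (q, b)); split=> //; first by rewrite /in_star all_rcons /= qv.
  by rewrite ez' e -cats1 val_cat mulgA.
have [->|z0] := pselect (z = [::]); first by exists [::], [::]; rewrite mulg1.
exfalso.
have zl s m t : z = s ++ m :: t -> in_link m.1 s -> ~~ ((m.1 == v) || adj v m.1).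
  by move=> ez ms; apply/negP => mv; apply: z_left; exists s, m, t.
have zr m t s : z = s ++ m :: t -> in_link m.1 t -> ~~ ((m.1 == v') || adj v' m.1).
  by move=> ez ms; apply/negP => mv; apply: z_right; exists s, m, t.
have r1 := conj_rcons_irreducible (c := true) (c' := true) z_irr zl zr z0.
have r2 := conj_rcons_irreducible (c := false) (c' := false) z_irr zl zr z0.
have [z' [l ez]] : exists z' l, z = rcons z' l.
  by case/lastP: z z0 {r1 r2 zr zl z_right z_left z_irr cz zn} => // z' l; exists z', l.
(* The inverse of this word is [z^-1 v^-1 z v'^-1], hence the negative signs in [r2]. *)
have r3 : ~ reducible (rcons ((v', true) :: word_inv z ++ (v, true) :: z') l).
  move=> r; apply: r2; apply: reducible_inv.
  rewrite word_inv_cat -cat1s word_inv_cat -cats1 word_inv_cat word_invK -!catA /=.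
  by move: r; rewrite rcons_cons rcons_cat rcons_cons -ez.
have : raag_eq adj (rcons ((v', true) :: word_inv z ++ (v, true) :: z') l)
    (rcons (word_inv z ++ (v, true) :: z) (v', true)).
  rewrite rcons_cons rcons_cat rcons_cons -ez; apply/word_valP.
  rewrite -/(gen v') -cats1 val_cons -/(gen v').
  by rewrite val_cat !val_cat val_cons val_inv; rewrite conjgE in cz; rewrite -cz.
move: r1; rewrite -rcons_cons -rcons_cat => r1.
move=> /(last_letters adj_sym adj_irr r3 r1) /= h.
move: (zr l [::] z'); rewrite cats1 => /(_ ez isT).
by case: h => [->|]; rewrite ?eqxx // adj_sym => ->; rewrite orbT.
Qed.

(** The factors in the two stars can be conjugated away, leaving [v v' = v' v], whose last letters
    are compared. *)
Lemma commute_conj_adj v v' z : commute (gen v ^ val z) (gen v') ->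
  v = v' \/ adj v v'.
Proof.
move=> c; have [a [b [va vb e]]] := commute_conj_gen c.
have {c} c : commute (gen v) (gen v').
  apply: (conjg_inj (val b)); rewrite conjMg [RHS]conjMg.
  have -> : gen v' ^ val b = gen v' by rewrite conjgE (star_commute vb) mulKg.
  move: c; rewrite e conjgM.
  by have -> : gen v ^ val a = gen v by rewrite conjgE (star_commute va) mulKg.
have [|vv'] := eqVneq v v'; first by left.
have irr u u' : u != u' -> ~ reducible (rcons [:: (u, true)] (u', true)).
  move=> uu' /(reducible_rcons adj_sym adj_irr)[[[|x [|y s]] [q [d [t [r []]]]]] //|].
  - by case: t.
  - by rewrite /pil /= /push /= eq_sym (negbTE uu'); case: (adj _ _).
have := last_letters adj_sym adj_irr (irr _ _ vv') (irr v' v _).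
rewrite eq_sym => /(_ vv') []; last 2 first.
- by left.
- by right; rewrite adj_sym.
by apply/word_valP; rewrite /= !val_cons !val_nil !mulg1.
Qed.

End Centralizer.

(** * Graph distance and the tree of a free product *)

Lemma leastP (P : nat -> Prop) n : P n -> P (least P) /\ (least P <= n)%N.
Proof.
move=> Pn; have ex : exists m, `[< P m >] by exists n; apply/asboolP.
have [m /asboolP Pm min_m] := ex_minnP ex.
have [] : P (least P) /\ (forall k, P k -> (least P <= k)%N).
  rewrite /least; apply: (@xgetPex _ 0%N (fun n => P n /\ forall m, P m -> (n <= m)%N)).
  by exists m; split=> // k Pk; apply/min_m/asboolP.
by move=> Pl /(_ n Pn).
Qed.

Section GraphDistance.
Variables (T : eqType) (adj : rel T).

Definition reach (x y : T) := exists p, path adj x p /\ last x p = y.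

Lemma reach_trans y x z : reach x y -> reach y z -> reach x z.
Proof.
move=> [p [xp <-]] [q [yq <-]]; exists (p ++ q).
by rewrite cat_path xp last_cat.
Qed.

Lemma graph_dist_le x p : path adj x p -> (graph_dist adj x (last x p) <= size p)%N.
Proof.
move=> xp; rewrite /graph_dist.
by case: (@leastP (fun n => exists q : seq T,
  [/\ path adj x q, last x q = last x p & size q = n]) (size p)) => //; exists p.
Qed.

Lemma graph_distP x y : reach x y -> exists p,
  [/\ path adj x p, last x p = y & size p = graph_dist adj x y].
Proof.
move=> [p [xp xy]]; rewrite /graph_dist.
by case: (@leastP (fun n => exists q : seq T,
  [/\ path adj x q, last x q = y & size q = n]) (size p)) => //; exists p.
Qed.

Lemma graph_distxx x : graph_dist adj x x = 0%N.
Proof. by apply/eqP; rewrite -leqn0 (@graph_dist_le x [::]). Qed.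

Lemma graph_dist_adj x y : adj x y -> (graph_dist adj x y <= 1)%N.
Proof. by move=> xy; apply: (@graph_dist_le x [:: y]); rewrite /= xy. Qed.

(** Reachability keeps the default value 0 of the distance off the right-hand side. *)
Lemma graph_dist_triangle y x z : reach x y -> reach y z ->
  (graph_dist adj x z <= graph_dist adj x y + graph_dist adj y z)%N.
Proof.
move=> /graph_distP[p [xp <- <-]] /graph_distP[q [yq <- <-]].
by rewrite -size_cat -last_cat graph_dist_le // cat_path xp.
Qed.

Hypothesis adj_sym : symmetric adj.

Lemma reach_sym x y : reach x y -> reach y x.
Proof.
move=> [p [xp <-]]; exists (rev (belast x p)); split.
  by rewrite rev_path; under eq_path do rewrite adj_sym.
by case: p xp => //= z p _; rewrite rev_cons last_rcons.
Qed.

Lemma graph_dist_sym x y : reach x y -> graph_dist adj x y = graph_dist adj y x.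
Proof.
suff le x' y' : reach x' y' -> (graph_dist adj y' x' <= graph_dist adj x' y')%N.
  by move=> xy; apply/eqP; rewrite eqn_leq !le //; apply: reach_sym.
move=> /graph_distP[p [xp <- <-]].
rewrite -(size_belast x' p) -size_rev.
have e : last (last x' p) (rev (belast x' p)) = x'.
  by case: p xp => //= z p _; rewrite rev_cons last_rcons.
rewrite -[X in graph_dist _ _ X]e; apply: graph_dist_le.
by rewrite rev_path; under eq_path do rewrite adj_sym.
Qed.

End GraphDistance.

Lemma reach_homo (T T' : eqType) (adj : rel T) (adj' : rel T') (f : T -> T') x y :
  {homo f : a b / adj a b >-> adj' a b} -> reach adj x y -> reach adj' (f x) (f y).
Proof.
move=> hf [p [xp <-]]; exists (map f p); rewrite last_map; split=> //.
exact: homo_path xp.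
Qed.

Lemma graph_dist_homo (T T' : eqType) (adj : rel T) (adj' : rel T') (f : T -> T') x y :
  {homo f : a b / adj a b >-> adj' a b} -> reach adj x y ->
  (graph_dist adj' (f x) (f y) <= graph_dist adj x y)%N.
Proof.
move=> hf /graph_distP[p [xp <- <-]].
by rewrite -(size_map f) -last_map graph_dist_le //; apply: homo_path xp.
Qed.

(** * Normal forms in the free group on [u] and [w], and the potential *)

Section Syllables.
Variables (V : finType) (adj : rel V).
Hypotheses (adj_sym : symmetric adj) (adj_irr : irreflexive adj).
Variables u w : V.
Hypotheses (uw : u != w) (nadj_uw : ~~ adj u w).

Local Notation val := (word_val adj).
Local Notation gen := (gen adj).

Local Open Scope ring_scope.

(* Normal forms in the free group on [u] and [w]: the syllable [(true, e)]
   stands for [u^e] and [(false, e)] for [w^e]. *)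
Local Notation syllables := (seq (bool * int)).

Definition wf (s : syllables) :=
  sorted (fun x y => x.1 != y.1) s && all (fun x => x.2 != 0) s.

Definition add_syllable (c : bool) (e : int) (s : syllables) : syllables :=
  if s is (c', e') :: s' then
    if c == c' then if e' + e == 0 then s' else (c', e' + e) :: s'
    else (c, e) :: s
  else [:: (c, e)].

Definition letter_sign (b : bool) : int := if b then 1 else -1.

(** Left multiplication by the image of a letter in the free group; [foldr step] lets a whole word
    act. *)
Definition step (l : V * bool) (s : syllables) : syllables :=
  if l.1 == u then add_syllable true (letter_sign l.2) s
  else if l.1 == w then add_syllable false (letter_sign l.2) s else s.

Lemma wf_add_syllable c (e : int) s : e != 0 -> wf s -> wf (add_syllable c e s).
Proof.
rewrite /wf => e0; case: s => [_|[c' e'] s] /=; first by rewrite e0.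
move=> /and3P[cs e'0 s0].
case: eqP => [ec|/eqP cc'] /=; last by rewrite cc' cs e0 e'0.
case: eqP => [ee|/eqP ee] /=; last by rewrite ee s0 !andbT; case: s cs {s0}.
by rewrite s0 andbT; apply: path_sorted cs.
Qed.

Lemma add_syllableK c (e : int) s : e != 0 -> wf s ->
  add_syllable c (- e) (add_syllable c e s) = s.
Proof.
rewrite /wf => e0; case: s => [_|[c' e'] s] /=; first by rewrite eqxx subrr eqxx.
move=> /and3P[cs e'0 s0].
case: eqP => [ec|/eqP cc'] /=; last by rewrite eqxx subrr eqxx.
case: eqP => [ee|/eqP ee] /=; last by rewrite ec eqxx addrK (negbTE e'0).
have -> : - e = e' by lia.
case: s cs s0 => [|[c2 e2] s] /=; first by rewrite ec.
by rewrite ec => /andP[/negbTE -> _].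
Qed.

Lemma wf_step l s : wf s -> wf (step l s).
Proof.
by move=> ws; rewrite /step; case: ifP => _; [|case: ifP => _ //];
  apply: wf_add_syllable => //; case: l.2.
Qed.

Lemma wf_foldr s x : wf s -> wf (foldr step s x).
Proof. by move=> ws; elim: x => //= l x IH; apply: wf_step. Qed.

Lemma foldr_raag_eq s x y : wf s -> raag_eq adj x y ->
  foldr step s x = foldr step s y.
Proof.
move=> ws; elim=> [//|//|x' y' z' _ -> _ //||] s' t.
- move=> v b; rewrite !foldr_cat /=; congr foldr.
  have wt := wf_foldr t ws.
  have e : letter_sign b = - letter_sign (~~ b) by case: b.
  rewrite /step /= e; case: (v == u); [|case: (v == w) => //];
    by apply: add_syllableK => //; case: b {e}.
- move=> p q pq; rewrite !foldr_cat /=; congr foldr; rewrite /step /=.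
  case: (eqVneq p u) pq => [->|pu pq].
    case: (eqVneq q u) => [->|qu]; first by rewrite adj_irr.
    by case: eqP nadj_uw => [<- /negbTE ->|].
  case: (eqVneq p w) pq => [-> |//].
  case: (eqVneq q u) => [->|qu]; first by rewrite adj_sym (negbTE nadj_uw).
  by case: eqP => [->|//]; rewrite adj_irr.
Qed.

Lemma foldr_nseq_u s n b : (forall e s', s <> (true, e) :: s') ->
  exists e, foldr step s (nseq n.+1 (u, b)) = (true, e) :: s.
Proof.
move=> hs; exists (letter_sign b * n.+1%:Z); elim: n => [|n IH].
  rewrite /= /step /= eqxx mulr1.
  by case: s hs => [//|[[] e] s] //= /(_ e s).
rewrite -[nseq _ _]/([:: (u, b)] ++ nseq n.+1 (u, b)) foldr_cat IH /step /= eqxx.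
have -> : letter_sign b * n.+1%:Z + letter_sign b = letter_sign b * n.+2%:Z.
  by rewrite /letter_sign; case: b {IH}; lia.
by case: eqP => // e; have := e; rewrite /letter_sign; case: b {IH e}; lia.
Qed.

Lemma foldr_nseq_w s n b : (forall e s', s <> (false, e) :: s') ->
  exists e, foldr step s (nseq n.+1 (w, b)) = (false, e) :: s.
Proof.
move=> hs; exists (letter_sign b * n.+1%:Z); elim: n => [|n IH].
  rewrite /= /step /= eq_sym (negbTE uw) eqxx mulr1.
  by case: s hs => [//|[[] e] s] //= /(_ e s).
rewrite -[nseq _ _]/([:: (w, b)] ++ nseq n.+1 (w, b)) foldr_cat IH /step /=.
rewrite eq_sym (negbTE uw) eqxx.
have -> : letter_sign b * n.+1%:Z + letter_sign b = letter_sign b * n.+2%:Z.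
  by rewrite /letter_sign; case: b {IH}; lia.
by case: eqP => // e; have := e; rewrite /letter_sign; case: b {IH e}; lia.
Qed.

(** The powers of [u] and [w] alternate, so nothing merges. That the form never begins with [w]
    keeps the induction going and later fixes the end of the edge. *)
Lemma foldr_power k l b c n :
  let s := foldr step [::] (flatten (nseq n (nseq k.+1 (u, b) ++ nseq l.+1 (w, c)))) in
  size s = n.*2 /\ forall e s', s <> (false, e) :: s'.
Proof.
elim: n => [//|n [sz IH]].
rewrite -[nseq n.+1 _]cat1s flatten_cat [flatten [:: _]]cats0 !foldr_cat.
set s := foldr _ _ (flatten _) in sz IH *.
have [e ->] := foldr_nseq_w l c IH.
have [e' ->] : exists e', foldr step ((false, e) :: s) (nseq k.+1 (u, b)) =
   (true, e') :: (false, e) :: s by apply: foldr_nseq_u.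
by rewrite /= sz.
Qed.

Local Open Scope nat_scope.

Variables (D : nat) (r : V -> nat).
Hypotheses (r_u : forall v, (v == u) || adj v u -> r v = 0)
  (r_w : forall v, (v == w) || adj v w -> r v = D)
  (r_le : forall v, r v <= D)
  (r_lip : forall v v', adj v v' -> r v <= (r v').+1).

(* The vertex [gen v ^ x] is sent to the point at distance [r v] from the end
   [<u> x] of the edge [x] in the Bass-Serre tree of the free product
   [<u> * <w>], whose edges have length [D]; [potential] is the distance from
   this point to the edge of the identity. *)
Definition potential (v : V) (s : syllables) : nat :=
  if s is (c, _) :: s' then D * size s' + (if c then r v else D - r v) else 0.

(** If [u] is in the star of [v], the point of [v] is the end [<u> x], shared by the edges of [x]
    and [u x]; similarly for [w]. Other letters are killed. *)
Lemma potential_star v l s : wf s -> (l.1 == v) || adj v l.1 ->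
  potential v (step l s) = potential v s.
Proof.
move=> ws lv; rewrite /step; case: eqP => [lu|_]; last case: eqP => [lw|//].
- have r0 : r v = 0 by apply: r_u; rewrite -lu eq_sym.
  move: ws; rewrite /wf; case: s => [|[[] e] s] /=; first by rewrite muln0 r0.
    move=> /and3P[hs _ _]; case: eqP => _ //=; rewrite r0.
    by case: s hs => [|[[] e'] s'] //= _; rewrite ?muln0 // mulnS; lia.
  by rewrite r0 mulnS; lia.
- have rD : r v = D by apply: r_w; rewrite -lw eq_sym.
  move: ws; rewrite /wf; case: s => [|[[] e] s] /=; first by rewrite muln0 rD subnn.
    by rewrite rD mulnS; lia.
  move=> /and3P[hs _ _]; case: eqP => _ //=; rewrite rD.
  by case: s hs => [|[[] e'] s'] //= _; rewrite ?muln0 ?subnn // mulnS; lia.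
Qed.

Lemma potential_in_star v x s : wf s -> in_star adj v x ->
  potential v (foldr step s x) = potential v s.
Proof.
move=> ws; elim: x => //= l x IH /andP[lv /IH <-].
by apply: potential_star => //; apply: wf_foldr.
Qed.

Lemma potential_lip v v' s : v = v' \/ adj v v' ->
  potential v s <= (potential v' s).+1.
Proof.
case=> [->//|vv']; case: s => [//|[[] e] s] /=.
  by have := r_lip vv'; lia.
have := r_lip (v := v') (v' := v); rewrite adj_sym => /(_ vv').
by have := r_le v; have := r_le v'; lia.
Qed.

Definition vertex_potential v (x : raag adj) :=
  potential v (foldr step [::] (word_of x)).

Local Open Scope group_scope.

Lemma vertex_potentialE v x : vertex_potential v (val x) =
  potential v (foldr step [::] x).
Proof.
congr potential; apply: foldr_raag_eq => //.
by apply/word_valP; rewrite word_ofK.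
Qed.

(** Write [x = a b y]. Removing [a] preserves the potential of [v], and inserting [b] before [y]
    preserves that of [v']; both points then lie on the edge of [b y], where [r] is Lipschitz. *)
Lemma vertex_potential_lip v v' x y : commute (gen v ^ x) (gen v' ^ y) ->
  (vertex_potential v x <= (vertex_potential v' y).+1)%N.
Proof.
move=> c; have {}c : commute (gen v ^ val (word_of (x / y))) (gen v').
  apply: (conjg_inj y); rewrite conjMg [RHS]conjMg.
  by rewrite word_ofK -conjgM mulgVK.
have vv' := commute_conj_adj adj_sym adj_irr c.
have [a [b [va vb e]]] := commute_conj_gen adj_sym adj_irr c.
have -> : x = val (a ++ b ++ word_of y).
  by rewrite !val_cat mulgA -e !word_ofK mulgVK.
rewrite vertex_potentialE !foldr_cat.
rewrite potential_in_star //; last by rewrite -foldr_cat; apply: wf_foldr.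
rewrite /vertex_potential -[X in (_ <= X.+1)%N](potential_in_star _ vb).
  exact: potential_lip.
exact: wf_foldr.
Qed.

(** The extra 1 pays for the last vertex being written as a conjugate in two ways: equal elements
    commute, so the previous bound applies. *)
Lemma vertex_potential_path v v' x y p :
    path (@ext_adj V adj) (gen v ^ x) p -> last (gen v ^ x) p = gen v' ^ y ->
  (vertex_potential v' y <= vertex_potential v x + size p + 1)%N.
Proof.
elim: p v x => [|z p IH] v x /=.
  move=> _ e; rewrite addn0 addn1; apply: vertex_potential_lip.
  by rewrite e; apply: commute_refl.
move=> /andP[/asboolP[_ [v1 [x1 ->]] _ c]] /IH{}IH /IH{}IH.
have := vertex_potential_lip (commute_sym c); lia.
Qed.

End Syllables.

(** * The extension graph *)

Section ExponentSum.
Variables (V : finType) (adj : rel V) (f : V -> int).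
Local Open Scope ring_scope.

(** The homomorphism to the integers that sends the generator [v] to [f v]. It separates generators
    and, for weights of absolute value at most 1, bounds word length from below. *)
Definition exponent_sum (w : seq (V * bool)) : int :=
  \sum_(l <- w) letter_sign l.2 * f l.1.

Lemma exponent_sum_cat w w' :
  exponent_sum (w ++ w') = exponent_sum w + exponent_sum w'.
Proof. exact: big_cat. Qed.

Lemma exponent_sum_nseq n v b :
  exponent_sum (nseq n (v, b)) = n%:Z * (letter_sign b * f v).
Proof.
rewrite /exponent_sum; elim: n => [|n IH]; first by rewrite big_nil mul0r.
by rewrite [nseq _ _]/= big_cons IH intS mulrDl mul1r.
Qed.

Lemma exponent_sum_raag_eq w w' : raag_eq adj w w' ->
  exponent_sum w = exponent_sum w'.
Proof.
elim=> // [x y z _ -> _ //|s t v b|s t u v _];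
  rewrite /exponent_sum !big_cat /= !big_cons big_nil; last by ring.
by rewrite /letter_sign; case: b => /=; ring.
Qed.

Lemma exponent_sum_le w : (forall v, `|f v| <= 1) ->
  exponent_sum w <= (size w)%:Z.
Proof.
move=> f1; rewrite /exponent_sum; elim: w => [|[v b] w IH];
  rewrite ?big_nil ?big_cons //=.
have := f1 v; rewrite ler_norml => /andP[f1l f1r].
move: (bigop _ _ _) IH => S; rewrite /letter_sign; case: b; lia.
Qed.

End ExponentSum.

(** * Connectedness of the extension graph and estimates of its metric *)

Section ExtensionGraph.
Variables (V : finType) (adj : rel V).
Hypotheses (adj_irr : irreflexive adj)
  (adj_conn : forall u v : V, connect adj u v).

Local Notation val := (word_val adj).
Local Notation gen := (gen adj).
Local Notation ext_adj := (@ext_adj V adj).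
Local Notation ext_vertex := (@ext_vertex V adj).

Local Open Scope group_scope.

Lemma adj_reach u v : reach adj u v.
Proof. by have /connectP[p up ->] := adj_conn u v; exists p. Qed.

Lemma gen_inj : injective gen.
Proof.
move=> u v /word_valP /(exponent_sum_raag_eq (fun x => (x == u)%:R%R)).
rewrite /exponent_sum !big_seq1 /= eqxx !mul1r.
by case: eqP.
Qed.

Lemma ext_adj_sym : symmetric ext_adj.
Proof.
by move=> x y; apply/asboolP/asboolP => -[ex ey xy c]; split=> //;
  by [move/esym | apply: commute_sym].
Qed.

Lemma ext_vertexJ x h : ext_vertex x -> ext_vertex (x ^ h).
Proof. by move=> [v [k ->]]; exists v, (k * h); rewrite conjgM. Qed.

Lemma ext_vertex_gen v : ext_vertex (gen v).
Proof. by exists v, 1; rewrite conjg1. Qed.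

Lemma ext_adjJ h : {homo (fun x : raag adj => x ^ h) : x y / ext_adj x y}.
Proof.
move=> x y /asboolP[ex ey xy c]; apply/asboolP; split; try exact: ext_vertexJ.
  by move/conjg_inj.
by rewrite /commute -conjMg c conjMg.
Qed.

Lemma ext_adj_gen : {homo gen : u v / adj u v >-> ext_adj u v}.
Proof.
move=> u v uv; apply/asboolP; split; try exact: ext_vertex_gen.
  by move/gen_inj => e; rewrite e adj_irr in uv.
exact: gen_commute.
Qed.

Lemma reachJ x y h : reach ext_adj x y -> reach ext_adj (x ^ h) (y ^ h).
Proof. exact: reach_homo (@ext_adjJ h). Qed.

Lemma reach_gen u v : reach ext_adj (gen u) (gen v).
Proof. exact: reach_homo ext_adj_gen (adj_reach u v). Qed.

(** Conjugating by a letter of [q] fixes the vertex [q], so successive translates of the defining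
    graph along a word for [h] meet. *)
Lemma reach_gen_conj u v h : reach ext_adj (gen u) (gen v ^ h).
Proof.
rewrite -(word_ofK h); elim: (word_of h) v => [|[q b] x IH] v.
  by rewrite val_nil conjg1; apply: reach_gen.
apply: (reach_trans (IH q)); rewrite val_cons conjgM; apply: reachJ.
set a := (if b then _ else _).
have {1}-> : gen q = gen q ^ a.
  have c : commute (gen q) a.
    by rewrite /a; case: b {a}; [|apply: commuteV]; apply: commute_refl.
  by rewrite conjgE c mulKg.
exact/reachJ/reach_gen.
Qed.

Lemma ext_reach x y : ext_vertex x -> ext_vertex y -> reach ext_adj x y.
Proof.
move=> [u [h ->]] [v [k ->]]; apply: (@reach_trans _ _ (gen u)).
  exact/(reach_sym ext_adj_sym)/reach_gen_conj.
exact: reach_gen_conj.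
Qed.

Lemma ext_dist_triangle y x z : ext_vertex x -> ext_vertex y -> ext_vertex z ->
  (ext_dist x z <= ext_dist x y + ext_dist y z)%N.
Proof. by move=> *; apply: graph_dist_triangle; apply: ext_reach. Qed.

Lemma ext_dist_sym x y : ext_vertex x -> ext_vertex y -> ext_dist x y = ext_dist y x.
Proof. by move=> *; apply: (graph_dist_sym ext_adj_sym); apply: ext_reach. Qed.

Lemma ext_distJ x y h : ext_vertex x -> ext_vertex y ->
  (ext_dist (x ^ h)%g (y ^ h)%g <= ext_dist x y)%N.
Proof.
by move=> ex ey; apply: graph_dist_homo (@ext_adjJ h) _; apply: ext_reach.
Qed.

Lemma ext_dist_gen u v : (ext_dist (gen u) (gen v) <= graph_dist adj u v)%N.
Proof. exact: graph_dist_homo ext_adj_gen (adj_reach u v). Qed.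

Lemma ext_dist_orbit_le x g n : ext_vertex x ->
  (ext_dist x (x ^ (g ^+ n))%g <= n * ext_dist x (x ^ g)%g)%N.
Proof.
move=> ex; elim: n => [|n IH]; first by rewrite expg0 conjg1 /ext_dist graph_distxx.
have eJ h := ext_vertexJ h ex.
rewrite mulSn; apply: leq_trans (ext_dist_triangle ex (eJ g) (eJ _)) _.
rewrite leq_add2l expgSr conjgM; exact: leq_trans (ext_distJ _ ex (eJ _)) IH.
Qed.

Lemma ext_dist_conj_le x y h : ext_vertex x -> ext_vertex y ->
  (ext_dist x (x ^ h)%g <= ext_dist y (y ^ h)%g + (ext_dist x y).*2)%N.
Proof.
move=> ex ey; have eJ := ext_vertexJ.
have := ext_dist_triangle ex ey (eJ _ h ex).
have := ext_dist_triangle ey (eJ _ h ey) (eJ _ h ex).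
have := ext_distJ h ey ex; rewrite (ext_dist_sym ey ex); lia.
Qed.

End ExtensionGraph.

Section Ratio.
Local Open Scope classical_set_scope.
Local Open Scope ring_scope.

Lemma lim_ratio (R : realType) (a : nat -> nat) (c C : nat) :
    (forall n, (a n <= c * n + C)%N /\ (c * n <= a n + C)%N) ->
  (lim ((a n)%:R / (n%:R : R) @[n --> \oo]) = c%:R :> R)%R.
Proof.
(* The shift removes the term with denominator 0. *)
move=> h; apply/cvg_lim => //; rewrite -cvg_shiftS /=.
have hC : (C%:R * harmonic n : R)%R @[n --> \oo] --> (0 : R)%R.
  by rewrite -(mulr0 (C%:R : R)%R); apply: cvgMr; apply: cvg_harmonic.
apply: (@squeeze_cvgr _ _ _ _ (fun n => c%:R - C%:R * harmonic n : R)%R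
  (fun n => c%:R + C%:R * harmonic n : R)%R).
- apply: nearW => n; have [h1 h2] := h n.+1.
  have n0 : (0 < n.+1%:R :> R)%R by rewrite ltr0n.
  rewrite /harmonic /=.
  rewrite -(ler_nat R) natrD natrM in h1; rewrite -(ler_nat R) natrM natrD in h2.
  rewrite ler_pdivlMr // ler_pdivrMr // mulrBl mulrDl !mulfVK ?gt_eqF //.
  by apply/andP; split; lra.
- by rewrite -[X in _ --> X]subr0; apply: cvgB => //; apply: cvg_cst.
- by rewrite -[X in _ --> X]addr0; apply: cvgD => //; apply: cvg_cst.
Qed.

End Ratio.

(** * Products of two syllables *)

Local Open Scope ring_scope.

Section TwoSyllables.
Variables (V : finType) (adj : rel V).
Hypotheses (adj_sym : symmetric adj) (adj_irr : irreflexive adj)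
  (adj_conn : forall u v : V, connect adj u v).

Local Notation val := (word_val adj).
Local Notation gen := (gen adj).
Local Notation ext_vertex := (@ext_vertex V adj).
Local Notation dist := (graph_dist adj).

Local Open Scope group_scope.

Lemma translation_length_bounds (R : realType) (g x y : raag adj) (c C : nat) :
    ext_vertex x -> ext_vertex y ->
    (forall n, (ext_dist y (y ^ (g ^+ n))%g <= c * n + C)%N /\
       (c * n <= ext_dist y (y ^ (g ^+ n))%g + C)%N) ->
  translation_length R x g = c%:R%R.
Proof.
move=> ex ey h; apply: (@lim_ratio R _ c (C + (ext_dist x y).*2)) => n.
have [h1 h2] := h n.
have := ext_dist_conj_le adj_irr adj_conn (g ^+ n) ex ey.
have := ext_dist_conj_le adj_irr adj_conn (g ^+ n) ey ex.
rewrite (ext_dist_sym adj_irr adj_conn ey ex); lia.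
Qed.

Lemma translation_length_fix (R : realType) (g x y : raag adj) :
  ext_vertex x -> ext_vertex y -> commute y g -> translation_length R x g = 0%R.
Proof.
move=> ex ey c; apply: (@translation_length_bounds R g x y 0 0) => // n.
by rewrite conjgE (commuteX n c) mulKg /ext_dist graph_distxx.
Qed.

Lemma val_nseq v b n : val (nseq n (v, b)) = (if b then gen v else (gen v)^-1) ^+ n.
Proof. by elim: n => [|n IH]; rewrite ?expg0 // expgS -IH -val_cons. Qed.

Lemma val_flatten_nseq w n : val (flatten (nseq n w)) = val w ^+ n.
Proof. by elim: n => [|n IH]; rewrite ?expg0 // expgS -IH -val_cat. Qed.

Lemma syllable_word x : @syllable V adj x ->
  exists v b n, x = val (nseq n.+1 (v, b)).
Proof.
move=> [v [[|n] [// _ [->|->]]]]; first by exists v, true, n; rewrite val_nseq.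
by exists v, false, n; rewrite val_nseq expVgn.
Qed.

Lemma two_syllables_word (g : raag adj) : syllable_length g = 2 ->
  exists u w b c k l, g = val (nseq k.+1 (u, b) ++ nseq l.+1 (w, c)).
Proof.
(* Without any factorization the minimum would default to 0, not 2. *)
rewrite /syllable_length /least; case: xgetP => // n _ [[s [sn hs <-]] _] n2.
move: sn hs; rewrite {}n2; case: s => [|x1 [|x2 [|? ?]]] //= _ hs.
have [u [b [k ->]]] := syllable_word (hs x1 (mem_head _ _)).
have [|w [c [l ->]]] := syllable_word (hs x2 _); first by rewrite !inE eqxx orbT.
by exists u, w, b, c, k, l; rewrite !big_cons big_nil mulg1 -val_cat.
Qed.

Section Word.
Variables (u w : V) (b c : bool) (k l : nat).
Let W := nseq k.+1 (u, b) ++ nseq l.+1 (w, c).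

(** The weight [f] makes every letter of [W] count 1, so the exponent sum of [W] is its length, a
    lower bound for any word with the same value. *)
Lemma two_syllables_reduced : u != w -> reduced adj W.
Proof.
move=> uw x /word_valP.
pose f v : int := ((v == u)%:R * letter_sign b + (v == w)%:R * letter_sign c)%R.
move=> /(exponent_sum_raag_eq f) e; rewrite -lez_nat.
apply: le_trans (exponent_sum_le _ (f := f) _).
  rewrite e /W exponent_sum_cat !exponent_sum_nseq /f size_cat !size_nseq !eqxx.
  rewrite (negbTE uw) eq_sym (negbTE uw) /letter_sign.
  by case: b; case: c; lia.
move=> v; rewrite /f /letter_sign; case: (eqVneq v u) => [->|_].
  by rewrite (negbTE uw); case: b; case: c.
by case: eqP; case: b; case: c.
Qed.

Lemma two_syllables_support v1 v2 : u != w ->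
  raag_support (val W) = [set v1; v2]%SET ->
  (v1 = u /\ v2 = w) \/ (v1 = w /\ v2 = u).
Proof.
move=> uw e; have inW v : v \in [seq x.1 | x <- W] -> v \in [set v1; v2]%SET.
  move=> vW; rewrite -e inE; apply/asboolP; exists W; split=> //.
  exact: two_syllables_reduced.
have : u \in [set v1; v2]%SET by apply: inW; rewrite /= inE eqxx.
have : w \in [set v1; v2]%SET.
  by apply: inW; rewrite map_cat mem_cat /= !inE eqxx !orbT.
move: uw; rewrite !inE => uw /orP[] /eqP ew /orP[] /eqP eu; subst.
- by rewrite eqxx in uw.
- by right.
- by left.
- by rewrite eqxx in uw.
Qed.

Lemma translation_length_close (R : realType) x : (dist u w <= 2)%N ->
  ext_vertex x -> translation_length R x (val W) = 0%R.
Proof.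
move=> d2 ex.
suff [z [zu zw]] : exists z, (u == z) || adj z u /\ (w == z) || adj z w.
  apply: (translation_length_fix R ex (ext_vertex_gen adj z)).
  rewrite /W val_cat; apply: commuteM; apply: star_commute; apply/allP => m;
    by rewrite mem_nseq => /andP[_ /eqP->].
have [p [up ew ep]] := graph_distP (adj_reach adj_conn u w).
rewrite -ep in d2; case: p up ew d2 {ep} => [|y [|z [|? ?]]] //=.
- by move=> _ <- _; exists u; rewrite eqxx.
- by rewrite andbT => uy <- _; exists u; rewrite eqxx uy orbT.
- move=> /and3P[uy yz _] <- _; exists y.
  by rewrite yz adj_sym uy !orbT.
Qed.

Lemma translation_length_far (R : realType) x : (3 <= dist u w)%N ->
  ext_vertex x -> translation_length R x (val W) = (2 * (dist u w - 2))%:R%R.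
Proof.
move=> d3 ex; set D := (dist u w - 2)%N.
have uw : u != w by apply: contraTneq d3 => ->; rewrite graph_distxx.
have nuw : ~~ adj u w by apply: contraTN d3 => /graph_dist_adj; lia.
have tri := graph_dist_triangle (adj_reach adj_conn _ _) (adj_reach adj_conn _ _).
have gsym a a' : dist a a' = dist a' a.
  exact: (graph_dist_sym adj_sym (adj_reach adj_conn a a')).
(* The truncated predecessor vanishes on the star of [u]; on the star of [w] the distance from [u]
   is at least [D + 1], so the cap [D] is attained. *)
pose r v := minn (dist u v).-1 D.
have r_u v : (v == u) || adj v u -> r v = 0%N.
  rewrite /r => /orP[/eqP->|]; first by rewrite graph_distxx min0n.
  by rewrite adj_sym => /graph_dist_adj; lia.
have r_w v : (v == w) || adj v w -> r v = D.
  rewrite /r /D => /orP[/eqP->|/graph_dist_adj vw]; first by lia.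
  by have := tri v u w; lia.
have r_le v : (r v <= D)%N by rewrite /r geq_minr.
have r_lip v v' : adj v v' -> (r v <= (r v').+1)%N.
  move=> /graph_dist_adj vv'; have := tri v' u v; rewrite (gsym v' v) /r; lia.
have [p [q [pu qw pq]]] : exists p q, [/\ adj p u, adj q w & (dist p q <= D)%N].
  have [s [us es ss]] := graph_distP (adj_reach adj_conn u w).
  rewrite /D -ss; rewrite -ss in d3.
  case: s us es d3 {ss} => [//|p s] /= /andP[up]; case/lastP: s => [//|s z].
  rewrite last_rcons rcons_path size_rcons => /andP[ps qz] ez _.
  exists p, (last p s); rewrite adj_sym up -ez qz; split=> //.
  by rewrite subn2 graph_dist_le.
have ep := ext_vertex_gen adj p; have eq := ext_vertex_gen adj q.
have eJ := fun h => ext_vertexJ h ep.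
apply: (@translation_length_bounds R _ x (gen p) _ (D + 1)) => // n; split.
  apply: leq_trans (ext_dist_orbit_le adj_irr adj_conn _ _ ep) _.
  suff : (ext_dist (gen p) (gen p ^ val W)%g <= 2 * D)%N by nia.
  (* The power of [u] fixes [p] and the power of [w] fixes [q], so the path through [q] has two
     halves of length at most [D]. *)
  have -> : gen p ^ val W = gen p ^ val (nseq l.+1 (w, c)).
    rewrite /W val_cat conjgM; congr (_ ^ _).
    rewrite conjgE (star_commute (v := p)) ?mulKg //.
    by apply/allP => m; rewrite mem_nseq => /andP[_ /eqP->]; rewrite pu orbT.
  have fixq : gen q ^ val (nseq l.+1 (w, c)) = gen q.
    rewrite conjgE (star_commute (v := q)) ?mulKg //.
    by apply/allP => m; rewrite mem_nseq => /andP[_ /eqP->]; rewrite qw orbT.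
  have := ext_dist_triangle adj_irr adj_conn ep eq (eJ (val (nseq l.+1 (w, c)))).
  have := ext_distJ adj_irr adj_conn (val (nseq l.+1 (w, c))) eq ep.
  have := ext_dist_gen adj_irr adj_conn p q.
  by rewrite fixq (ext_dist_sym adj_irr adj_conn eq ep); lia.
case: n => [|n]; first by rewrite muln0.
have [s [ps es ss]] := graph_distP
  (ext_reach adj_irr adj_conn ep (eJ (val W ^+ n.+1))).
rewrite -[ext_dist _ _]ss.
have {}ps : path (@ext_adj V adj) (gen p ^ 1) s by rewrite conjg1.
have {}es : last (gen p ^ 1) s = gen p ^ (val W ^+ n.+1) by rewrite conjg1.
have := vertex_potential_path adj_sym adj_irr uw nuw r_u r_w r_le r_lip ps es.
have -> : vertex_potential u w D r p (1 : raag adj) = 0%N.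
  exact: (vertex_potentialE adj_sym adj_irr uw nuw D r p [::]).
(* The image of [g^(n+1)] has [2n + 2] syllables and begins with [u], and [r p = 0], so the
   potential is [D (2n + 1)]. The missing [D] and the slack 1 of the path bound give the constant
   [D + 1]. *)
rewrite -val_flatten_nseq vertex_potentialE //.
have [] := foldr_power uw nuw k l b c n.+1; rewrite -/W.
case: foldr => [//|[[] e] t] /=; last by move=> _ /(_ e t).
by move=> [->] _; rewrite r_u ?pu ?orbT //; nia.
Qed.

End Word.

End TwoSyllables.

Theorem proposition6p12 (R : realType) (V : finType) (adj : rel V)
    (adj_sym : symmetric adj) (adj_irr : irreflexive adj)
    (adj_conn : forall u v : V, connect adj u v)
    (g : raag adj) (g_lox : loxodromic R g)
    (g_len : syllable_length g = 2%N) (x : raag adj) (hx : ext_vertex x) :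
  translation_length R x g \is a Num.int /\
  (forall v1 v2 : V, raag_support g = [set v1; v2]%SET ->
     translation_length R x g = 2 * (graph_dist adj v1 v2)%:R - 4).
Proof.
have [u [w [b [c [k [l eg]]]]]] := two_syllables_word g_len.
(* The case of distance at most 2, which includes [u = w], contradicts loxodromicity at the vertex
   [y] that witnesses it. *)
subst g; have [d3|d2] := ltnP 2 (graph_dist adj u w); last first.
  have [y ey] := g_lox.
  by rewrite translation_length_close // ltxx.
rewrite translation_length_far //; split; first exact: natr_int.
have uw : u != w by apply: contraTneq d3 => ->; rewrite graph_distxx.
have E : (2 * (graph_dist adj u w - 2))%:R = 2 * (graph_dist adj u w)%:R - 4 :> R.
  by rewrite natrM natrB ?(ltnW d3) //; ring.
move=> v1 v2 /(two_syllables_support uw)[[-> ->]//|[-> ->]].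
by rewrite (graph_dist_sym adj_sym (adj_reach adj_conn w u)).
Qed.
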